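(* Let $n\ge 1$ and let $\mathcal{H}$ be an $n$-uniform linear hypergraph with exactly $n$ hyperedges $F_1,\dots,F_n$. Then the identifier spanning trees can be chosen so that the resulting auxiliary graph of the second kind $G_2(\mathcal{H})$ admits a Vandermonde-completable orientation of its identifier edges.
   Context: A hypergraph is linear if any two distinct edges share at most one vertex; for $v\in V(\mathcal{H})$, $d(v)$ is the number of edges containing $v$. The auxiliary graph of the second kind $G_2(\mathcal{H})$ is the graph built as follows. For each $i=1,\dots,n$ take a copy $K_n^{(i)}$ of the complete graph $K_n$ (the $i$-th base clique) with vertices $v_{i,1},\dots,v_{i,n}$, labelled bijectively by the $n$ vertices of $F_i$; the base cliques are vertex-disjoint, so each $v\in V(\mathcal{H})$ labels exactly $d(v)$ vertices. For each $v\in V(\mathcal{H})$ choose a spanning tree (identifier spanning tree) on the set of the $d(v)$ vertices labelled by $v$. For each edge $v_{i,j}v_{k,l}$ of an identifier spanning tree with $i<k$, the edges $v_{i,j}v_{k,t}$ for all $t\ne l$ (each with multiplicity one) are added to $G_2(\mathcal{H})$; these are the identifier edges. The edge set of $G_2(\mathcal{H})$ consists of the edges of the base cliques together with the identifier edges. An orientation of the identifier edges is called Vandermonde-completable if the edges of the base cliques can be oriented so that each base clique becomes a transitive tournament and every vertex of the whole graph $G_2(\mathcal{H})$ has in-degree at most $n-1$. *)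

(* Defs.v *)
From mathcomp Require Import all_boot.
Set Implicit Arguments.
Unset Strict Implicit.
Unset Printing Implicit Defensive.

(* A hypergraph on V is its set of hyperedges; vertices of degree 0 are       *)
(* allowed.                                                                   *)
Definition uniform_hypergraph (V : finType) (n : nat) (H : {set {set V}}) :=
  forall A, A \in H -> #|A| = n.

Definition linear_hypergraph (V : finType) (H : {set {set V}}) :=
  forall A B, A \in H -> B \in H -> A != B -> #|A :&: B| <= 1.

Definition enumerates_edges (V : finType) (n : nat)
    (F : 'I_n -> {set V}) (H : {set {set V}}) :=
  injective F /\ [set F i | i : 'I_n] = H.

Definition simple_graph (T : finType) (e : rel T) :=
  symmetric e /\ irreflexive e.

Definition acyclic (T : finType) (e : rel T) :=
  forall c : seq T, 2 < size c -> ~ ucycle e c.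

(* For S = set0 this forces e to be empty, so a vertex of degree 0 simply has *)
(* an empty tree.                                                             *)
Definition spanning_tree_on (T : finType) (S : {set T}) (e : rel T) :=
  [/\ simple_graph e,
      forall x y, e x y -> (x \in S) && (y \in S),
      {in S &, forall x y, connect e x y}
    & acyclic e].

(* o x y means that the edge xy is directed from x to y; every edge receives  *)
(* exactly one of its two directions.                                         *)
Definition orientation (T : finType) (e o : rel T) :=
  forall x y, if e x y then o x y (+) o y x else ~~ o x y.

Definition transitive_tournament_on (T : finType) (S : {set T}) (o : rel T) :=
  [/\ {in S, forall x, ~~ o x x},
      {in S &, forall x y, x != y -> o x y (+) o y x}
    & {in S & &, transitive o}].

Definition indegree (T : finType) (o : rel T) (x : T) := #|[set y | o y x]|.

(* The vertex v_{i,j} of the i-th base clique is the pair (i, j), and lab i j *)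
(* is the vertex of the hypergraph labelling it.                              *)
Definition labelling (V : finType) (n : nat) (F : 'I_n -> {set V})
    (lab : 'I_n -> 'I_n -> V) :=
  forall i, injective (lab i) /\ [set lab i j | j : 'I_n] = F i.

Definition labelled_by (V : finType) (n : nat) (lab : 'I_n -> 'I_n -> V)
    (v : V) : {set 'I_n * 'I_n} :=
  [set x | lab x.1 x.2 == v].

Definition identifier_spanning_trees (V : finType) (n : nat)
    (lab : 'I_n -> 'I_n -> V) (tree : V -> rel ('I_n * 'I_n)) :=
  forall v, spanning_tree_on (labelled_by lab v) (tree v).

Definition base_clique (n : nat) (i : 'I_n) : {set 'I_n * 'I_n} :=
  [set x | x.1 == i].

Definition base_edge (n : nat) : rel ('I_n * 'I_n) :=
  fun x y => (x.1 == y.1) && (x != y).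

(* x = v_{i,j} and y = v_{k,t} with i < k, coming from a tree edge            *)
(* v_{i,j} v_{k,l} with t <> l.                                               *)
Definition identifier_link (V : finType) (n : nat)
    (tree : V -> rel ('I_n * 'I_n)) : rel ('I_n * 'I_n) :=
  fun x y => (x.1 < y.1) &&
    [exists v : V, exists l : 'I_n, tree v x (y.1, l) && (y.2 != l)].

Definition identifier_edge (V : finType) (n : nat)
    (tree : V -> rel ('I_n * 'I_n)) : rel ('I_n * 'I_n) :=
  fun x y => identifier_link tree x y || identifier_link tree y x.

Definition G2 (V : finType) (n : nat)
    (tree : V -> rel ('I_n * 'I_n)) : rel ('I_n * 'I_n) :=
  fun x y => base_edge x y || identifier_edge tree x y.

(* o orients the identifier edges; O is its completion to the whole graph.    *)
Definition Vandermonde_completable (V : finType) (n : nat)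
    (tree : V -> rel ('I_n * 'I_n)) (o : rel ('I_n * 'I_n)) :=
  exists O : rel ('I_n * 'I_n),
    [/\ orientation (G2 tree) O,
        forall x y, identifier_edge tree x y -> O x y = o x y,
        forall i : 'I_n, transitive_tournament_on (base_clique i) O
      & forall x, indegree O x <= n - 1].

(* Main.v *)
Require Import Defs.
From mathcomp Require Import all_boot perm zify.

Set Implicit Arguments.
Unset Strict Implicit.
Unset Printing Implicit Defensive.

(** Take as identifier spanning tree of [v] the path visiting the cliques
    containing [v] in increasing order.  In every clique [k] (numbered from 0)
    choose a ranking of the vertices by [0, ..., n-1] such that a vertex whose
    successor on its path lies in clique [k'] has rank [n - (k' - k)], and any
    other vertex whose predecessor lies in clique [i] has rank [i].  By
    linearity this prescribes distinct ranks, at least [k + 1] in the first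
    case and less than [k] in the second.  Orient the clique from higher to
    lower rank, so that a vertex of rank [r] has in-degree [n - 1 - r] inside
    its clique, and orient the identifier edge from [x] in clique [i] to [y] in
    clique [k] towards [y] if and only if the rank of [y] lies strictly between
    [i] and [k].  A vertex of clique [k] of rank [r < k] then receives at most
    one identifier edge from each clique [i < r]; a vertex of rank [r >= k]
    receives none unless it has a successor, in clique [k'] say, and then it
    receives [(n - 1) - (k' - 1 - k) = r] of them. *)

(** * Extension of a partial injection to a permutation *)

Lemma perm_extending_rel (T : finType) (R : rel T) :
  (forall a b b', R a b -> R a b' -> b = b') ->
  (forall a a' b, R a b -> R a' b -> a = a') ->
  exists s : {perm T}, forall a b, R a b -> s a = b.
Proof.
move=> R_fun R_inj.
suff [s sP]: exists s : {perm T}, forall a b, a \in enum T -> R a b -> s a = b.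
  by exists s => a b; apply: sP; rewrite mem_enum.
elim: (enum T) => [|a0 A [s sP]]; first by exists 1%g.
have [a0A|a0A] := boolP (a0 \in A).
  by exists s => a b; rewrite inE => /orP[/eqP->|]; apply: sP.
case: (pickP (R a0)) => [b0 Rb0|noR]; last first.
  by exists s => a b; rewrite inE => /orP[/eqP->|]; [rewrite noR | apply: sP].
(* The transposition corrects the image of [a0] and fixes [s a] for every other related [a] in [A]:
   it differs from [s a0], and from [b0] by [R_inj]. *)
exists (s * tperm (s a0) b0)%g => a b; rewrite inE permM => /orP[/eqP->|aA] Rab.
  by rewrite tpermL (R_fun _ _ _ Rb0 Rab).
have aa0 : a0 != a by apply: contraNneq a0A => ->.
rewrite (sP _ _ aA Rab) tpermD // -?(sP _ _ aA Rab) ?(inj_eq perm_inj) //.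
rewrite (sP _ _ aA Rab); apply: contraNneq aa0 => eb.
by rewrite eb in Rb0; rewrite (R_inj _ _ _ Rb0 Rab).
Qed.

(** * Identifier trees as paths through the occurrences of a vertex *)

Section ConsecutiveOccurrences.

Variables (V : finType) (n : nat) (lab : 'I_n -> 'I_n -> V).

Implicit Types x y z : 'I_n * 'I_n.

Definition consecutive : rel ('I_n * 'I_n) := fun x y =>
  [&& lab x.1 x.2 == lab y.1 y.2, x.1 < y.1 &
    [forall z, (lab z.1 z.2 == lab x.1 x.2) ==> ~~ (x.1 < z.1 < y.1)]].

Definition path_tree (v : V) : rel ('I_n * 'I_n) := fun x y =>
  (lab x.1 x.2 == v) && (consecutive x y || consecutive y x).

Lemma consecutiveP x y :
  reflect [/\ lab x.1 x.2 = lab y.1 y.2, x.1 < y.1 &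
             forall z, lab z.1 z.2 = lab x.1 x.2 -> x.1 < z.1 -> y.1 <= z.1]
          (consecutive x y).
Proof.
apply: (iffP and3P) => [[/eqP exy xy /forallP cxy]|[exy xy cxy]]; split=> //.
- move=> z ez xz; have := cxy z; rewrite ez eqxx xz /= -leqNgt; apply.
- exact/eqP.
- by apply/forallP => z; apply/implyP => /eqP /cxy c; apply/andP => -[/c]; rewrite leqNgt => /negP.
Qed.

Hypothesis lab_inj : forall i, injective (lab i).

Lemma eq_label_clique x y : lab x.1 x.2 = lab y.1 y.2 -> x.1 = y.1 -> x = y.
Proof.
by case: x y => [i j] [k l] /= + e; rewrite -e => /lab_inj ->.
Qed.

Lemma consecutive_fun x y y' : consecutive x y -> consecutive x y' -> y = y'.
Proof.
move=> /consecutiveP[e xy c] /consecutiveP[e' xy' c'].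
apply: eq_label_clique; first by rewrite -e -e'.
apply: val_inj => /=; have := c y'; have := c' y.
by rewrite -e -e' => /(_ erefl xy) ? /(_ erefl xy') ?; lia.
Qed.

Lemma consecutive_inj x x' y : consecutive x y -> consecutive x' y -> x = x'.
Proof.
move=> /consecutiveP[e xy c] /consecutiveP[e' xy' c'].
apply: eq_label_clique; first by rewrite e e'.
apply: val_inj => /=; have := c x'; have := c' x.
by rewrite e e' => /(_ erefl) ? /(_ erefl) ?; lia.
Qed.

Lemma path_tree_sym v : symmetric (path_tree v).
Proof.
suff imp x y : path_tree v x y -> path_tree v y x by move=> x y; apply/idP/idP; apply: imp.
case/andP => /eqP ex /orP[] cxy; rewrite /path_tree cxy ?orbT andbT.
  by case/consecutiveP: cxy => <- _ _; rewrite ex.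
by case/consecutiveP: cxy => -> _ _; rewrite ex.
Qed.

Lemma path_tree_connect v x y :
  lab x.1 x.2 = v -> lab y.1 y.2 = v -> x.1 <= y.1 -> connect (path_tree v) x y.
Proof.
have [m] := ubnP (val y.1); elim: m y => // m IH y /ltnSE ym ex ey.
rewrite leq_eqVlt => /orP[/eqP/val_inj xy|xy].
  by rewrite (eq_label_clique _ xy) ?ex ?ey.
pose P z := (lab z.1 z.2 == v) && (z.1 < y.1).
have Px : P x by rewrite /P ex eqxx.
(* The last occurrence of [v] before [y] is the predecessor of [y]; induction joins it to [x]. *)
case: (arg_maxnP (fun z => val z.1) Px) => z /andP[/eqP ez zy] zmax.
have zm : z.1 < m by exact: leq_trans ym.
apply: connect_trans (IH z zm ex ez (zmax x Px)) (connect1 _).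
rewrite /path_tree ez eqxx; apply/orP; left; apply/consecutiveP.
split=> [||w]; rewrite ?ez ?ey // => ew zw; rewrite leqNgt; apply/negP => wy.
by have /= := zmax w; rewrite /P ew eqxx wy => /(_ isT); lia.
Qed.

(** In the highest clique that a cycle meets, a vertex of the cycle would have two distinct
    neighbours on it, both predecessors on its path; predecessors are unique. *)
Lemma path_tree_acyclic v : acyclic (path_tree v).
Proof.
move=> c sz_c /andP[cyc_c uniq_c].
have [x0 x0c] : exists x0, x0 \in c.
  by case: c sz_c {cyc_c uniq_c} => // a *; exists a; rewrite mem_head.
case: (arg_maxnP (fun z => val z.1) x0c) => x xc xmax.
have nb y : y \in c -> path_tree v x y -> consecutive y x.
  move=> yc /andP[_ /orP[/consecutiveP[_ xy _]|//]].
  by have /= := xmax y yc; lia.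
case/rot_to: xc => i s def_c.
have sub_c y : y \in x :: s -> y \in c by rewrite -def_c mem_rot.
move: cyc_c uniq_c sz_c.
(* After rotation the neighbours of [x] are the second and the last vertex of the cycle. *)
rewrite -(rot_cycle i) -(rot_uniq i) -(size_rot i) def_c.
case: s sub_c {def_c} => [|y s] // sub_c; case/lastP: s sub_c => // s z sub_c.
rewrite /= -rcons_cons rcons_path last_rcons => /and3P[exy _ ezx].
rewrite path_tree_sym in ezx.
have yc : y \in c by apply: sub_c; rewrite !inE eqxx orbT.
have zc : z \in c by apply: sub_c; rewrite !inE mem_rcons mem_head !orbT.
have yz := consecutive_inj (nb y yc exy) (nb z zc ezx).
by case/and3P => _ + _; rewrite yz mem_rcons inE eqxx.
Qed.

Lemma path_tree_spanning v : spanning_tree_on (labelled_by lab v) (path_tree v).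
Proof.
split.
- split; first exact: path_tree_sym.
  by move=> x; rewrite /path_tree /consecutive ltnn !andbF.
- move=> x y exy; rewrite !inE; have := exy; rewrite path_tree_sym.
  by case/andP: exy => -> _ /andP[->].
- move=> x y; rewrite !inE => /eqP ex /eqP ey.
  have [xy|/ltnW yx] := leqP x.1 y.1; first exact: path_tree_connect.
  rewrite (sym_connect_sym (path_tree_sym v)); exact: path_tree_connect.
- exact: path_tree_acyclic.
Qed.

End ConsecutiveOccurrences.

(** * Rankings of the base cliques *)

Section Ranking.

Variables (V : finType) (n : nat) (lab : 'I_n -> 'I_n -> V).

Implicit Types x y z : 'I_n * 'I_n.

Hypothesis lab_inj : forall i, injective (lab i).
Hypothesis lab_linear : forall i k a a' b b', i != k ->
  lab i a = lab k b -> lab i a' = lab k b' -> a = a'.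

Local Notation consecutive := (consecutive lab).

(** Two distinct path edges between the same two cliques would give these cliques two common labels,
    against [lab_linear]. *)
Lemma consecutive_clique_fun x x' y y' : x.1 = x'.1 -> y.1 = y'.1 ->
  consecutive x y -> consecutive x' y' -> x = x'.
Proof.
case: x x' y y' => [i a] [i' a'] [k b] [k' b'] /= <- <-.
move=> /consecutiveP[/= e ik _] /consecutiveP[/= e' _ _].
by rewrite (lab_linear _ e e') // neq_ltn ik.
Qed.

Lemma consecutive_clique_inj x x' y y' : x.1 = x'.1 -> y.1 = y'.1 ->
  consecutive x y -> consecutive x' y' -> y = y'.
Proof.
case: x x' y y' => [i a] [i' a'] [k b] [k' b'] /= <- <-.
move=> /consecutiveP[/= /esym e ik _] /consecutiveP[/= /esym e' _ _].
by rewrite (lab_linear _ e e') // neq_ltn ik orbT.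
Qed.

(** The second property keeps the rank of a successor out of the gap between the two cliques, as the
    last in-degree count requires. *)
Lemma ranking_exists : exists rk : 'I_n -> {perm 'I_n},
  (forall x y, consecutive x y -> rk x.1 x.2 + y.1 = n + x.1) /\
  (forall x y, consecutive x y ->
     (rk y.1 y.2 <= x.1) || (y.1 <= rk y.1 y.2)).
Proof.
(* The rank equation is additive to avoid truncated subtraction. In [R], a successor takes
   precedence over a predecessor. *)
pose out k a (b : 'I_n) :=
  [exists y, consecutive (k, a) y && (b + y.1 == n + k)].
pose inn k a (b : 'I_n) := [exists z, consecutive z (k, a) && (z.1 == b)].
pose R k a b := out k a b || [forall y, ~~ consecutive (k, a) y] && inn k a b.
have RP k a b : R k a b ->
    (exists y, consecutive (k, a) y /\ b + y.1 = n + k) \/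
    (forall y, ~~ consecutive (k, a) y) /\
      exists z, consecutive z (k, a) /\ z.1 = b.
  case/orP=> [/existsP[y /andP[cy /eqP e]]|/andP[/forallP nc]].
    by left; exists y.
  by case/existsP=> z /andP[cz /eqP e]; right; split=> //; exists z.
have R_fun k a b b' : R k a b -> R k a b' -> b = b'.
  case/RP=> [[y [cy e]]|[nc [z [cz <-]]]] /RP[[y' [cy' e']]|[nc' [z' [cz' <-]]]].
  - rewrite -(consecutive_fun lab_inj cy cy') in e'.
    by apply: val_inj => /=; lia.
  - by rewrite (negPf (nc' y)) in cy.
  - by rewrite (negPf (nc y')) in cy'.
  - by rewrite (consecutive_inj lab_inj cz cz').
(* Ranks set by successors exceed [k] and ranks set by predecessors are below [k], so the two kinds
   never collide. *)
have out_lt (k : 'I_n) y z : z.1 + y.1 = n + k -> k < z.1.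
  by have := ltn_ord y.1; lia.
have in_lt k a z : consecutive z (k, a) -> z.1 < k by case/consecutiveP.
have R_inj k a a' b : R k a b -> R k a' b -> a = a'.
  case/RP=> [[y [cy e]]|[_ [z [cz e]]]] /RP[[y' [cy' e']]|[_ [z' [cz' e']]]].
  - suff yy' : y.1 = y'.1.
      by case: (@consecutive_clique_fun (k, a) (k, a') y y' erefl yy' cy cy').
    by apply: val_inj => /=; lia.
  - rewrite -e' in e; have := out_lt _ _ _ e; have := in_lt _ _ _ cz'; lia.
  - rewrite -e in e'; have := out_lt _ _ _ e'; have := in_lt _ _ _ cz; lia.
  - rewrite -e' in e.
    by case: (@consecutive_clique_inj z z' (k, a) (k, a') e erefl cz cz').
have [rk rkP] :=
  fin_all_exists (fun k => perm_extending_rel (R_fun k) (R_inj k)).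
have rk_out x y : consecutive x y -> rk x.1 x.2 + y.1 = n + x.1.
  case: x => k a cxy /=; have /consecutiveP[_ /= ky _] := cxy.
  have bn : n + k - y.1 < n by have := ltn_ord y.1; lia.
  rewrite (rkP _ _ (Ordinal bn)) /=; first by have := ltn_ord y.1; lia.
  apply/orP; left; apply/existsP; exists y.
  by rewrite cxy /=; have := ltn_ord y.1; lia.
exists rk; split=> // x [k b] cxy /=.
(* If [(k, b)] has a successor its rank is at least [k]; otherwise its rank is [x.1]. *)
case: (pickP (consecutive (k, b))) => [y cy|nc].
  apply/orP; right.
  by rewrite -(leq_add2r y.1) (rk_out _ _ cy) addnC leq_add2r ltnW.
rewrite (rkP _ _ x.1) ?leqnn //; apply/orP; right.
apply/andP; split; first by apply/forallP => y; rewrite nc.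
by apply/existsP; exists x; rewrite cxy /=.
Qed.

End Ranking.

(** * Counting in intervals of ordinals *)

Lemma card_ord_ltn (n b : nat) : b <= n -> #|[set p : 'I_n | p < b]| = b.
Proof.
by move=> bn; rewrite -sum1dep_card (big_ord_narrow bn) sum1_card card_ord.
Qed.

Lemma card_ord_between (n a b : nat) : a < b <= n ->
  #|[set p : 'I_n | a < p < b]| = b - a.+1.
Proof.
case/andP=> ab bn; have := cardsID [set p : 'I_n | p < a.+1] [set p : 'I_n | p < b].
rewrite card_ord_ltn //.
have -> : [set p : 'I_n | p < b] :&: [set p : 'I_n | p < a.+1] = [set p : 'I_n | p < a.+1].
  by apply/setP => p; rewrite !inE; lia.
have -> : [set p : 'I_n | p < b] :\: [set p : 'I_n | p < a.+1] = [set p : 'I_n | a < p < b].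
  by apply/setP => p; rewrite !inE; lia.
by rewrite card_ord_ltn; lia.
Qed.

Lemma leq_card_in_set (T U : finType) (f : T -> U) (A : {set T}) (B : {set U}) :
  {in A &, injective f} -> {in A, forall x, f x \in B} -> #|A| <= #|B|.
Proof.
move=> f_inj fAB; rewrite -(card_in_imset f_inj).
by apply/subset_leq_card/subsetP => _ /imsetP[x xA ->]; apply: fAB.
Qed.

(** * The orientation and its in-degrees *)

Section Orientation.

Variables (V : finType) (n : nat) (lab : 'I_n -> 'I_n -> V).
Variable rk : 'I_n -> {perm 'I_n}.

Implicit Types x y z : 'I_n * 'I_n.

Hypothesis lab_inj : forall i, injective (lab i).
Hypothesis lab_linear : forall i k a a' b b', i != k ->
  lab i a = lab k b -> lab i a' = lab k b' -> a = a'.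

Local Notation consecutive := (consecutive lab).
Local Notation link := (identifier_link (path_tree lab)).
Local Notation rank x := (rk x.1 x.2).

Hypothesis rank_out : forall x y, consecutive x y -> rank x + y.1 = n + x.1.
Hypothesis rank_in : forall x y, consecutive x y ->
  (rank y <= x.1) || (y.1 <= rank y).

Lemma linkP x y :
  reflect (exists2 l, consecutive x (y.1, l) & y.2 != l) (link x y).
Proof.
apply: (iffP andP) => [[xy /existsP[v /existsP[l /andP[/andP[_ exy] yl]]]]|].
  exists l => //; case/orP: exy => // /consecutiveP[_ /=]; lia.
case=> l cxy yl; split; first by case/consecutiveP: cxy.
apply/existsP; exists (lab x.1 x.2); apply/existsP; exists l.
by rewrite /path_tree eqxx cxy.
Qed.

Lemma rank_inj x y : x.1 = y.1 -> rank x = rank y -> x = y.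
Proof. by case: x y => [i a] [k b] /= <- /perm_inj ->. Qed.

(** In both identifier branches it is the rank of the endpoint in the later clique that decides; the
    last branch has [x] in that role. *)
Definition rank_orientation : rel ('I_n * 'I_n) := fun x y =>
  if x.1 == y.1 then rank y < rank x
  else if link x y then x.1 < rank y < y.1
  else link y x && ~~ (y.1 < rank x < x.1).

Lemma rank_orientationP : orientation (G2 (path_tree lab)) rank_orientation.
Proof.
move=> x y; rewrite /G2 /base_edge /identifier_edge /rank_orientation eq_sym.
have [e|ne] /= := eqVneq y.1 x.1.
  rewrite {1 2}/identifier_link e ltnn /= orbF.
  have [->|xy] /= := eqVneq x y; first by rewrite ltnn.
  have : (rank x : nat) != rank y.
    by apply: contraNneq xy => /val_inj/(rank_inj (esym e))/eqP.
  by rewrite e; case: ltngtP.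
have [lxy|nlxy] /= := boolP (link x y); last first.
  by case: (link y x) => //=; rewrite addNb addbb.
have -> : link y x = false.
  by apply/negP => /andP[yx _]; case/andP: lxy; lia.
by rewrite /= addbN addbb.
Qed.

Lemma rank_orientation_clique (i : 'I_n) :
  transitive_tournament_on (base_clique i) rank_orientation.
Proof.
rewrite /rank_orientation; split=> [x|x y|y x z]; rewrite !inE.
- by rewrite eqxx ltnn.
- move=> /eqP xi /eqP yi xy; rewrite xi yi eqxx -{1}yi -{1}xi.
  have : (rank x : nat) != rank y.
    by apply: contraNneq xy => /val_inj/rank_inj ->; rewrite ?xi ?yi.
  by rewrite xi yi; case: ltngtP.
- move=> /eqP-> /eqP-> /eqP->; rewrite !eqxx => yx zy; exact: ltn_trans yx.
Qed.

(** In-neighbours inside the clique ([A]) number at most [n - 1 - rank x], so those outside ([B])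
    may number at most [rank x]. *)
Lemma indegree_rank_orientation x : indegree rank_orientation x <= n - 1.
Proof.
have rn := ltn_ord (rank x).
pose A := [set y | (y.1 == x.1) && (rank x < rank y)].
pose B := [set y | (y.1 != x.1) && rank_orientation y x].
have : indegree rank_orientation x <= #|A| + #|B|.
  apply: leq_trans (leq_card_setU A B); apply/subset_leq_card/subsetP => y.
  by rewrite !inE /rank_orientation; case: eqP => /= _ ->.
have leA : #|A| <= n - (rank x).+1.
  rewrite -(@card_ord_between n (rank x) n) ?rn ?leqnn //.
  apply: (@leq_card_in_set _ _ (fun y => rank y)) => [y z|y]; rewrite !inE.
    by move=> /andP[/eqP <- _] /andP[/eqP e _]; apply: rank_inj.
  by move=> /andP[_ ->] /=.
suff leB : #|B| <= rank x by lia.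
have [x_low|x_high] := ltnP (rank x) x.1.
  rewrite -[leqRHS](card_ord_ltn (ltnW rn)).
  have BP y : y \in B -> y.1 < rank x /\ exists l, consecutive y (x.1, l).
    rewrite inE /rank_orientation => /andP[/negPf->].
    case: linkP => [[l cyx _] /andP[yx _]|_]; first by split=> //; exists l.
    (* An edge from a later clique would give [x] a successor, hence a rank above [x.1]. *)
    by case/andP => /linkP[l /rank_out/=]; have := ltn_ord y.1; lia.
  apply: (@leq_card_in_set _ _ (fun y => y.1)) => [y z /BP[_ [l cy]] /BP[_ [l' cz]]|y /BP[]].
    by move=> e; apply: consecutive_clique_fun cy cz.
  by rewrite inE.
(* An edge from an earlier clique points to [x] only if [rank x < x.1], so here only later cliques
   contribute. *)
have BP y : y \in B ->
    (exists2 l, consecutive x (y.1, l) & y.2 != l) /\ ~~ (x.1 < rank y < y.1).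
  rewrite inE /rank_orientation => /andP[/negPf->].
  by case: ifP => [_|_ /andP[/linkP]]; first lia.
have [no_s|[s cs]] : consecutive x =1 xpred0 \/ exists s, consecutive x s.
  by case: (pickP (consecutive x)) => [s|]; [right; exists s | left].
  suff -> : B = set0 by rewrite cards0.
  apply/setP => y; rewrite [RHS]inE; apply/negP => /BP[[l]].
  by rewrite no_s.
have {}BP y : y \in B -> [/\ y.1 = s.1, y != s & ~~ (x.1 < rank y < s.1)].
  case/BP=> -[l cl yl]; have es := consecutive_fun lab_inj cl cs.
  by rewrite -es /= => ?; split=> //; apply: contraNneq yl => ->.
(* The successor [s] is not joined to [x], so its rank is removed too; this saves the one unit that
   makes the size of [C] equal to [rank x]. *)
pose C := ~: [set p : 'I_n | x.1 < p < s.1] :\ rank s.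
have sC : rank s \in ~: [set p : 'I_n | x.1 < p < s.1].
  by rewrite !inE; have := rank_in cs; lia.
have leBC : #|B| <= #|C|.
  apply: (@leq_card_in_set _ _ (fun y => rank y)).
    by move=> y z /BP[e _ _] /BP[e' _ _]; apply: rank_inj; rewrite e e'.
  move=> y /BP[e ys ny]; rewrite !inE ny andbT.
  by apply: contraNneq ys => /rank_inj ->.
have /consecutiveP[_ xs _] := cs; have sn := ltn_ord s.1.
have := cardsC [set p : 'I_n | x.1 < p < s.1].
rewrite card_ord card_ord_between ?xs ?(ltnW sn) //.
rewrite (cardsD1 (rank s) (~: _)) sC -/C => cardC.
have {}cardC : (s.1 - x.1.+1) + (1 + #|C|) = n by exact: cardC.
by have := rank_out cs; lia.
Qed.

End Orientation.

Theorem mainTheorem3 (n : nat) (n_ge1 : 1 <= n) (V : finType)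
    (H : {set {set V}})
    (H_uniform : uniform_hypergraph n H) (H_linear : linear_hypergraph H)
    (F : 'I_n -> {set V}) (F_edges : enumerates_edges F H)
    (lab : 'I_n -> 'I_n -> V) (lab_F : labelling F lab) :
  exists tree : V -> rel ('I_n * 'I_n),
    identifier_spanning_trees lab tree /\
    exists o : rel ('I_n * 'I_n),
      orientation (identifier_edge tree) o /\ Vandermonde_completable tree o.
Proof.
have lab_inj i : injective (lab i) by case: (lab_F i).
have labF i j : lab i j \in F i by case: (lab_F i) => _ <-; apply: imset_f.
have [F_inj FH] := F_edges.
have lab_linear i k a a' b b' : i != k ->
    lab i a = lab k b -> lab i a' = lab k b' -> a = a'.
  move=> ik e e'; apply: (lab_inj i).
  have FiH j : F j \in H by rewrite -FH imset_f.
  have /card_le1_eqP := H_linear _ _ (FiH i) (FiH k) (contra_neq (@F_inj _ _) ik).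
  by apply; rewrite inE labF ?e ?e' labF.
have [rk [rk_out rk_in]] := ranking_exists lab_inj lab_linear.
pose O := rank_orientation lab rk.
have OP : orientation (G2 (path_tree lab)) O by exact: rank_orientationP.
exists (path_tree lab); split; first by move=> v; apply: path_tree_spanning.
pose I := identifier_edge (path_tree lab).
(* Restricting [O] to identifier edges leaves every other pair undirected, as [orientation]
   demands. *)
exists (fun x y => I x y && O x y); split.
  move=> x y /=; have Iyx : I y x = I x y by rewrite /I /identifier_edge orbC.
  by have := OP x y; rewrite Iyx /G2 -/I -/(I x y); case: (I x y); rewrite ?orbT.
exists O; split=> //.
- by move=> x y Ixy; rewrite /I Ixy.
- exact: rank_orientation_clique.
- exact: indegree_rank_orientation.
Qed.
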